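(* For arbitrary integers $k \ge 0$ and $d \ge 5$, putting $n := d^2+d-4+(d+1)k$, we have $$h_n(d) \le 2[(d-1)!]^{d-2}[(d-2)!]^k < f(n,d),$$ where $f(n,d) := (d-1)^2 [(d-2)!]^{\frac{n}{d+1}}$.
   Context: For integers $d$ and $n$, $h_n(d)$ denotes the minimum number of hamiltonian cycles over all hamiltonian $d$-regular graphs of order $n$ (and $h_n(d) := \infty$ if no hamiltonian $d$-regular graph of order $n$ exists). *)

(* Defs.v *)
From HB Require Import structures.
From mathcomp Require Import all_boot all_order all_algebra.
From mathcomp Require Import all_classical all_reals all_analysis.

Set Implicit Arguments.
Unset Strict Implicit.
Unset Printing Implicit Defensive.

Import Order.TTheory GRing.Theory Num.Theory.

Section Graphs.
Context {V : finType}.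

(* A finite simple graph with vertex type V is given by its edge set, every
   edge being a two-element set of vertices. *)
Implicit Types (E C : {set {set V}}) (s : seq V) (x : V).

Definition simple_graph E : bool := [forall A in E, #|A| == 2].

Definition degree E x : nat := #|[set A in E | x \in A]|.

Definition regular (d : nat) E : bool := [forall x, degree E x == d].

(* [next s x] is the successor of x in s read cyclically. *)
Definition cycle_edges s : {set {set V}} := [set [set x; next s x] | x in s].

(* A hamiltonian cycle is a subgraph, so it carries no orientation and no
   starting vertex; cycles have length at least 3. *)
Definition hamiltonian_cycle E C : bool :=
  [&& 2 < #|V|, C \subset E &
      [exists s : #|V|.-tuple V, uniq s && (C == cycle_edges s)]].

Definition num_hamiltonian_cycles E : nat :=
  #|[set C | hamiltonian_cycle E C]|.

Definition hamiltonian E : bool := [exists C, hamiltonian_cycle E C].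

End Graphs.

Local Open Scope ring_scope.

(* Up to isomorphism every graph of order n has vertex type 'I_n, so the
   minimum is over a finite type; its value is +oo if there is no such graph. *)
Definition min_ham (R : realType) (n d : nat) : \bar R :=
  \big[mine/+oo%E]_(E : {set {set 'I_n}} |
        [&& simple_graph E, regular d E & hamiltonian E])
     (num_hamiltonian_cycles E)%:R%:E.

(* The exponent n / (d + 1) is a real quotient and need not be an integer. *)
Definition f (R : realType) (n d : nat) : R :=
  (d%:R - 1) ^+ 2 * ((d - 2)`!)%:R `^ (n%:R / (d%:R + 1)).

(* Main.v *)
Require Import Defs.
From HB Require Import structures.
From mathcomp Require Import all_boot all_order all_algebra.
From mathcomp Require Import all_classical all_reals all_analysis.
From mathcomp Require Import zify.

Set Implicit Arguments.
Unset Strict Implicit.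
Unset Printing Implicit Defensive.

Import Order.TTheory GRing.Theory Num.Theory.

(** Take a path [r_0 ... r_(d-2)] and vertices [p_0, ..., p_(d-2)], join every
    [p_i] to every [r_j] except [p_i] to [r_i] for [0 < i < d - 2], and link [p_i]
    to [p_(i+1)] through a block, a copy of [K_(d+1)] minus an edge.  Then insert
    [k] ladder pieces around the first block: a piece is a copy of [K_(d+1)] on
    [v, a, b] and [d - 2] further vertices [m], minus the edges [va] and [vb]; the
    two free ends of [v] are put on the edge leaving [p_0], those of [a] and [b]
    on the edge entering [p_1].

    Each block, and each end part of the ladder, is separated by exactly two
    edges, so a hamiltonian cycle contains all these edges.  It therefore runs
    through the blocks and the pieces in order, avoiding the edges [p_i r_j] with
    [0 < i < d - 2] and the edges [vm], [ab], and finally runs along the path of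
    the [r_j] in one of two directions.  Each block can be traversed in [(d-1)!]
    ways and each piece in [(d-2)!] ways. *)

(** * Sequences and levels *)

(** Only upward steps are bounded, so [h] may fall freely. At the first [b] with
    [h b < c <= h b.+1], the step bound forces [h b.+1 = c]. *)
Lemma discrete_ivt (h : nat -> nat) a b c :
    a <= b -> (forall i, a <= i < b -> h i.+1 <= (h i).+1) ->
    h a <= c <= h b ->
  exists2 i, a <= i <= b & h i = c.
Proof.
move=> le_ab; elim: b le_ab => [|b IHb] le_ab step /andP[ge_c le_c].
  have a0 : a = 0 by lia.
  by rewrite a0 in ge_c *; exists 0; lia.
have [eq_ab|lt_ab] : a = b.+1 \/ a <= b by lia.
  by exists a; [lia | rewrite -eq_ab in le_c; lia].
have [le_cb|lt_bc] := leqP c (h b).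
  have [||i ? ?] := IHb lt_ab; [|by rewrite ge_c|by exists i; first lia].
  by move=> i ?; apply: step; lia.
have := step b; exists b.+1; lia.
Qed.

(** A change of direction at [i.+1] would give [h i = h i.+2]. This is applied to the stretch of a
    cycle that runs through the [r_j]. *)
Lemma unit_steps_monotone (h : nat -> nat) a b :
    (forall i, a <= i < b -> h i.+1 = (h i).+1 \/ h i = (h i.+1).+1) ->
    (forall i, a <= i -> i.+2 <= b -> h i <> h i.+2) ->
  (forall i, a <= i < b -> h i <= h i.+1) \/
  (forall i, a <= i < b -> h i.+1 <= h i).
Proof.
move=> step neq.
suff: (forall i, a <= i < b -> h i.+1 = (h i).+1) \/
      (forall i, a <= i < b -> h i = (h i.+1).+1).
  by case=> mono; [left | right] => i /mono; lia.
elim: b step neq => [|b IHb] step neq; first by left=> i; lia.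
have [lt_ba|le_ab] := ltnP b a.+1.
  have [|] : a = b \/ b < a by lia.
  - move=> eq_ab; have [|up|down] := step b; first lia.
    + by left=> i ?; have -> : i = b by lia.
    + by right=> i ?; have -> : i = b by lia.
  - by left=> i; lia.
have stepb := step b; have stepb1 := step b.-1; have neqb := neq b.-1.
have eqb : b.-1.+1 = b by lia.
rewrite eqb in stepb1 neqb.
case: IHb => [i ?|i ? ?|up|down]; [by apply: step; lia|by apply: neq; lia| |].
- left=> i ?; have [eq_ib|lt_ib] : i = b \/ i < b by lia.
    by have := up b.-1; rewrite eqb eq_ib; lia.
  by apply: up; lia.
- right=> i ?; have [eq_ib|lt_ib] : i = b \/ i < b by lia.
    by have := down b.-1; rewrite eqb eq_ib; lia.
  by apply: down; lia.
Qed.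

(* A descent either returns to a singleton level crossed before, or leaves a
   singleton level that has to be crossed again on the way up to [L]. *)
Lemma level_path_nondecreasing (T : eqType) (g : T -> nat) (x0 : T) (s : seq T)
    (L : nat) (single : pred nat) :
    uniq s -> g (nth x0 s 0) = 0 -> g (nth x0 s (size s).-1) = L ->
    (forall i, i < size s -> g (nth x0 s i) <= L) ->
    (forall i, i.+1 < size s -> g (nth x0 s i.+1) <= (g (nth x0 s i)).+1 /\
                                g (nth x0 s i) <= (g (nth x0 s i.+1)).+1) ->
    (forall x y, single (g x) -> g x = g y -> x = y) ->
    (forall l, l < L -> single l || single l.+1) ->
  forall i, i.+1 < size s -> g (nth x0 s i) <= g (nth x0 s i.+1).
Proof.
move=> us g0 gL leL step inj alt i lt_is; rewrite leqNgt; apply/negP=> desc.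
pose h j := g (nth x0 s j).
have eqh : h i = (h i.+1).+1 by have := step i lt_is; rewrite /h; lia.
have hiL : h i <= L by apply: leL; lia.
have /orP[sng|sng] : single (h i.+1) || single (h i.+1).+1 by apply: alt; lia.
- have [|j ?||j lt_j eqj] := @discrete_ivt h 0 i (h i.+1); [lia| | |].
  + by case: (step j); rewrite /h; lia.
  + by rewrite {1}/h g0; lia.
  have /(_ sng (esym eqj))/eqP := inj (nth x0 s i.+1) (nth x0 s j).
  by rewrite nth_uniq //; lia.
- have [|j ?||j lt_j eqj] := @discrete_ivt h i.+1 (size s).-1 (h i); [lia| | |].
  + by case: (step j); rewrite /h; lia.
  + have -> : h (size s).-1 = L by []; lia.
  rewrite -eqh in sng.
  have /(_ sng (esym eqj))/eqP := inj (nth x0 s i) (nth x0 s j).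
  by rewrite nth_uniq //; lia.
Qed.

(** This puts a level structure on ['I_n] itself, the vertex type in [min_ham]. The list [t], with
    [sz l] copies of each [l], has length [n], and its [i]-th entry serves as the level of [i]. *)
Lemma exists_levels (sz : nat -> nat) (N n : nat) :
    \sum_(0 <= l < N) sz l = n ->
  exists lev : 'I_n -> nat,
    forall l, #|[pred x | lev x == l]| = if l < N then sz l else 0.
Proof.
move=> sumN; pose t := flatten [seq nseq (sz l) l | l <- iota 0 N].
have sizet : size t = n.
  rewrite size_flatten /shape -map_comp -sumN sumnE big_map /index_iota subn0.
  by apply: eq_bigr => l _ /=; rewrite size_nseq.
have countt l : count_mem l t = if l < N then sz l else 0.
  rewrite count_flatten -map_comp sumnE big_map.
  under eq_bigr do rewrite /= count_nseq /=.
  case: ifP => lt_lN; last first.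
    by apply: big1_seq => m; rewrite mem_iota; case: eqVneq => [->|]; lia.
  rewrite (bigD1_seq l) ?iota_uniq ?mem_iota //= eqxx mul1n big1 ?addn0 //.
  by move=> m /negPf->.
exists (fun i => nth 0 t i).
move=> l; rewrite -countt -[t in RHS](@mkseq_nth _ 0) sizet /mkseq count_map.
rewrite -val_enum_ord count_map -size_filter cardE; congr size.
by rewrite /enum_mem -filter_predI; apply: eq_filter => i /=; rewrite !inE andbT.
Qed.

(** * Vertex listings sorted by level, and their number *)

Section SortedListings.
Context {V : finType}.
Implicit Types (lev : V -> nat) (s : seq V).

(** Kept as an explicit list because its length, a product of factorials, is the bound on the number
    of cycles. *)
Definition sorted_listings lev (r : seq nat) : seq (seq V) :=
  foldr (fun l acc => [seq p ++ q | p <- permutations (enum [pred x | lev x == l]),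
                                    q <- acc]) [:: [::]] r.

Lemma size_sorted_listings lev r :
  size (sorted_listings lev r) = \prod_(l <- r) (#|[pred x | lev x == l]|)`!.
Proof.
elim: r => [|l r IHr]; first by rewrite big_nil.
by rewrite big_cons /= size_allpairs size_permutations ?enum_uniq // IHr -cardE.
Qed.

Lemma sorted_listingsP lev N s :
    uniq s -> s =i V -> (forall x, lev x < N) -> sorted (relpre lev leq) s ->
  s \in sorted_listings lev (iota 0 N).
Proof.
move=> us fs ltN ss.
have fs' x : 0 <= lev x -> x \in s by rewrite fs.
have ge0 : {in s, forall x, 0 <= lev x} by [].
have {}ltN x : lev x < 0 + N by [].
(* The induction is generalised to a lower end [m]: [s] lists exactly the vertices of level at least
   [m], and removing level [m] leaves the same situation at [m.+1]. *)
move: 0 fs' ge0 ltN => m fs' ge_m lt_N; elim: N m s us fs' ge_m lt_N ss {fs} =>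
  [|N IHN] m s us fs ge_m lt_N ss.
  case: s us fs ge_m ss => // x s _ _ /(_ x (mem_head _ _)).
  by have := lt_N x; lia.
(* Since [s] is sorted and [m] is its least possible level, the vertices of level [m] form a
   prefix. *)
have -> : s = [seq x <- s | lev x == m] ++ [seq x <- s | lev x != m].
  elim: s ge_m ss {us fs} => //= x s IHs ge_m ss.
  have gex : m <= lev x by apply: ge_m; rewrite mem_head.
  have ge_s : {in s, forall x, m <= lev x}.
    by move=> y ys; apply: ge_m; rewrite inE ys orbT.
  have [eqx|nex] := eqVneq (lev x) m => /=.
    by congr cons; apply: IHs => //; apply: path_sorted ss.
  have ltx : {in s, forall y, lev y != m}.
    move=> y ys; have := order_path_min _ ss.
    move=> /(_ (fun a b c => @leq_trans _ _ _))/allP/(_ y ys) /=; lia.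
  rewrite (eq_in_filter (a2 := pred0)); last by move=> y /ltx/negPf.
  by rewrite filter_pred0 (eq_in_filter (a2 := predT)) ?filter_predT // => y /ltx.
apply/allpairsP; exists ([seq x <- s | lev x == m], [seq x <- s | lev x != m]).
split=> //=.
  rewrite mem_permutations; apply: uniq_perm; rewrite ?enum_uniq ?filter_uniq //.
  move=> x; rewrite mem_filter mem_enum inE.
  by have [eqx|//] := eqVneq (lev x) m; rewrite fs ?eqx.
apply: IHN; rewrite ?filter_uniq //.
- by move=> x ltx; rewrite mem_filter fs; lia.
- by move=> x; rewrite mem_filter => /andP[nex /ge_m]; lia.
- by move=> x; have := lt_N x; lia.
- by apply: sorted_filter ss => a b c; apply: leq_trans.
Qed.
End SortedListings.

(** * The level structure *)

(** Used with [c = 3] for the [k] copies of (a, m, b), and with [c = 4] for the [d - 3] groups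
    formed by some [p_(j+1)] and the block after it. *)
Lemma big_nat_blocks (S : Type) (idx : S) (op : Monoid.law idx) (F : nat -> S) (a c m : nat) :
  \big[op/idx]_(a <= i < a + c * m) F i =
  \big[op/idx]_(0 <= j < m) \big[op/idx]_(0 <= i < c) F (a + c * j + i).
Proof.
elim: m => [|m IHm]; first by rewrite muln0 addn0 !big_geq.
rewrite big_nat_recr //= -IHm (big_cat_nat (n := a + c * m)) //=; [|lia|lia].
congr (op _ _); rewrite -{1}[a + c * m]add0n big_addn.
have -> : a + c * m.+1 - (a + c * m) = c by lia.
by apply: eq_bigr => i _; rewrite addnC.
Qed.

Section LevelGraph.
Context (k d : nat).

(* A vertex is described by its level, a position along a hamiltonian cycle:
   [p_0] is at level 0, the ladder vertices [v] at 1 .. k, the first block at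
   k+1 .. k+3 (end, inside, end), the [j]-th of the [k] copies of (a, m, b) at
   k+4+3j .. k+6+3j, [p_(j+1)] and the block after it at 4k+4+4j .. 4k+7+4j,
   [p_(d-2)] at [top_level] and [r_j] at [top_level + 1 + j].  Only the inside of
   a block ([d - 1] vertices) and the [m] ([d - 2] vertices) form a level with
   more than one vertex.  Adjacency depends on the levels only. *)
Definition top_level : nat := 4 * k + 4 * (d - 2).
Definition num_levels : nat := top_level + d.

Definition block_level (l : nat) : bool :=
  (l == k + 2) || [&& 4 * k + 4 <= l, l < top_level & l %% 4 == 2].

Definition ladder_level (l : nat) : bool :=
  [&& k + 4 <= l, l < 4 * k + 4 & (l - (k + 4)) %% 3 == 1].

Definition level_size (l : nat) : nat :=
  if num_levels <= l then 0
  else if block_level l then d - 1 else if ladder_level l then d - 2 else 1.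

(* The piece attached to the [v] at level [a] is traversed in the reverse order,
   hence the equation for the level of its [m]. *)
Definition arc_VN (a b : nat) : bool := [&& 0 < a, a <= k & b + 3 * a == 4 * k + 5].

Definition arc_AB (a b : nat) : bool :=
  [&& k + 4 <= a, a < 4 * k + 4, (a - (k + 4)) %% 3 == 0 & b == a.+2].

(** The level of [p_i] is [a = 4 * k + 4 * i] for [0 < i < d - 2]; the final disequality then
    excludes exactly [b = top_level + 1 + i], the level of [r_i]. *)
Definition arc_PR (a b : nat) : bool :=
  [&& top_level < b, b < num_levels &
      [|| a == 0, a == top_level |
          [&& 4 * k + 4 <= a, a < top_level, a %% 4 == 0 &
              4 * b + 4 * k != a + 4 * top_level + 4]]].

Definition level_arc (a b : nat) : bool :=
  [|| b == a.+1, arc_VN a b, arc_AB a b | arc_PR a b].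

(** Reflexivity makes every level a clique. It also puts each vertex into its own neighbourhood,
    whence [d + 1] instead of [d] in [level_degree]. *)
Definition level_adj (a b : nat) : bool :=
  [|| a == b, level_arc a b | level_arc b a].

Lemma level_adj_sym : symmetric level_adj.
Proof. by move=> a b; rewrite /level_adj eq_sym [level_arc b a || _]orbC. Qed.

(** This and the next five facts discard whole families of arcs by range alone, before any
    definition has to be unfolded in the degree computation. *)
Lemma arc_VN_outl a b : ~~ (0 < a <= k) -> arc_VN a b = false.
Proof. by rewrite /arc_VN; lia. Qed.

Lemma arc_VN_outr a b : ~~ (k + 5 <= b <= 4 * k + 2) -> arc_VN a b = false.
Proof. by rewrite /arc_VN; lia. Qed.

Lemma arc_AB_outl a b : ~~ (k + 4 <= a < 4 * k + 4) -> arc_AB a b = false.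
Proof. by rewrite /arc_AB; lia. Qed.

Lemma arc_AB_outr a b : ~~ (k + 6 <= b < 4 * k + 6) -> arc_AB a b = false.
Proof. by rewrite /arc_AB; lia. Qed.

Lemma arc_PR_outl a b :
  ~~ [|| a == 0, a == top_level | 4 * k + 4 <= a < top_level] -> arc_PR a b = false.
Proof. by rewrite /arc_PR; lia. Qed.

Lemma arc_PR_outr a b : ~~ (top_level < b < num_levels) -> arc_PR a b = false.
Proof. by rewrite /arc_PR; lia. Qed.

Hypothesis hd : 5 <= d.

Lemma level_size_block l : block_level l -> level_size l = d - 1.
Proof.
rewrite /level_size => bl; rewrite bl.
by move: bl; case: leqP => //; rewrite /block_level /num_levels /top_level; lia.
Qed.

Lemma level_size_ladder l : ladder_level l -> level_size l = d - 2.
Proof.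
rewrite /level_size => bl; rewrite bl.
case: leqP; first by move: bl; rewrite /ladder_level /num_levels /top_level; lia.
by case: ifP => //; move: bl; rewrite /block_level /ladder_level; lia.
Qed.

Lemma level_size1 l :
  l < num_levels -> ~~ block_level l -> ~~ ladder_level l -> level_size l = 1.
Proof. by rewrite /level_size ltnNge => /negPf-> /negPf-> /negPf->. Qed.

Lemma level_size_out l : num_levels <= l -> level_size l = 0.
Proof. by rewrite /level_size => ->. Qed.

(** Over an arbitrary monoid, so that one splitting yields both the order of the graph (addition,
    identity) and the number of sorted listings (multiplication, factorial). *)
Lemma big_levels (S : Type) (idx : S) (op : Monoid.law idx) (F : nat -> S) :
  \big[op/idx]_(0 <= l < num_levels) F (level_size l) =
  op (\big[op/idx]_(0 <= l < k + 2) F 1)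
  (op (op (F (d - 1)) (F 1))
  (op (\big[op/idx]_(0 <= j < k) op (F 1) (op (F (d - 2)) (F 1)))
  (op (\big[op/idx]_(0 <= j < d - 3) op (F 1) (op (F 1) (op (F (d - 1)) (F 1))))
      (\big[op/idx]_(0 <= l < d) F 1)))).
Proof.
have single a b : b <= num_levels ->
    (forall l, a <= l < b -> ~~ block_level l /\ ~~ ladder_level l) ->
  \big[op/idx]_(a <= l < b) F (level_size l) = \big[op/idx]_(0 <= l < b - a) F 1.
  move=> le_b none; rewrite -{1}[a]add0n big_addn; apply: eq_big_nat => l ?.
  by have [|? ?] := none (l + a); first lia; rewrite level_size1 //; lia.
have split a b c G : a <= b -> b <= c -> \big[op/idx]_(a <= i < c) G i =
    op (\big[op/idx]_(a <= i < b) G i) (\big[op/idx]_(b <= i < c) G i).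
  exact: big_cat_nat.
have top_eq : top_level = 4 * k + 4 + 4 * (d - 3) by rewrite /top_level; lia.
have lad_eq : 4 * k + 4 = k + 4 + 3 * k by lia.
have le_top : 4 * k + 4 <= top_level by rewrite top_eq leq_addr.
rewrite (split 0 (k + 2)) 1?(split (k + 2) (k + 4)) 1?(split (k + 4) (4 * k + 4))
        1?(split (4 * k + 4) top_level) ?leq_addr //; try by rewrite /num_levels; lia.
congr (op _ _); [|congr (op _ _); [|congr (op _ _); [|congr (op _ _)]]].
- rewrite single ?subn0 //; first by rewrite /num_levels top_eq; lia.
  by move=> l; rewrite /block_level /ladder_level; lia.
- rewrite addn4 addn2 big_ltn // big_nat1 level_size_block; last by rewrite /block_level; lia.
  by rewrite level_size1 // /num_levels /block_level /ladder_level ?top_eq; lia.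
- rewrite lad_eq big_nat_blocks; apply: eq_big_nat => j ltj.
  do 3 rewrite big_ltn //; rewrite big_geq // Monoid.mulm1.
  rewrite level_size1; try by rewrite /num_levels /block_level /ladder_level; lia.
  rewrite level_size_ladder; last by rewrite /ladder_level; lia.
  by rewrite level_size1 // /num_levels /block_level /ladder_level; lia.
- rewrite top_eq big_nat_blocks; apply: eq_big_nat => j ltj.
  do 4 rewrite big_ltn //; rewrite big_geq // Monoid.mulm1.
  rewrite level_size1; try by rewrite /num_levels /block_level /ladder_level; lia.
  rewrite level_size1; try by rewrite /num_levels /block_level /ladder_level; lia.
  rewrite level_size_block; last by rewrite /block_level; lia.
  by rewrite level_size1 // /num_levels /block_level /ladder_level; lia.
- rewrite single //; first by congr bigop.body; rewrite /num_levels; congr index_iota; lia.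
  by move=> l; rewrite /block_level /ladder_level ?top_eq; lia.
Qed.

Lemma sum_level_size :
  \sum_(0 <= l < num_levels) level_size l = d ^ 2 + d - 4 + (d + 1) * k.
Proof.
rewrite (big_levels addn id) !sum_nat_const_nat /= !subn0 !muln1.
(* Writing [d] as [e + 5] makes the truncated subtractions harmless. *)
by have [e ->] : exists e, d = e + 5 by [exists (d - 5); lia]; nia.
Qed.

Lemma prod_level_size :
  \prod_(0 <= l < num_levels) (level_size l)`! = (d - 1)`! ^ (d - 2) * (d - 2)`! ^ k.
Proof.
rewrite (big_levels muln factorial) !prod_nat_const_nat !subn0 (_ : 1`! = 1) // !exp1n /=
  !muln1 !mul1n.
(* The first block stands apart from the other [d - 3]. *)
have -> : d - 2 = (d - 3).+1 by lia.
by rewrite expnS mulnAC mulnA.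
Qed.

(** Reduces a degree to an explicit duplicate-free list [t] of neighbouring levels. *)
Lemma sum_level_adj l (t : seq nat) :
    uniq t -> all (gtn num_levels) t ->
    (forall b, b < num_levels -> level_adj l b = (b \in t)) ->
  \sum_(0 <= b < num_levels | level_adj l b) level_size b = \sum_(b <- t) level_size b.
Proof.
move=> ut /allP ltt adjE; rewrite -big_filter; apply: perm_big.
apply: uniq_perm; rewrite ?filter_uniq ?iota_uniq // => b.
rewrite mem_filter mem_index_iota /=.
have [lt_b|ge_b] := ltnP b num_levels; first by rewrite andbT adjE.
by rewrite andbF; apply/esym/negP => /ltt /=; lia.
Qed.

(** The levels by role: [U], [M], [W] are the end, inside and other end of a block, with suffix [0]
    for the first block; [V], [A], [N], [B] are the [v], [a], [m], [b] of the ladder; [LevelP j] is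
    [p_(j+1)]. *)
Variant level_spec : nat -> Prop :=
  | Level0 : level_spec 0
  | LevelV j of 0 < j <= k : level_spec j
  | LevelU0 : level_spec (k + 1)
  | LevelM0 : level_spec (k + 2)
  | LevelW0 : level_spec (k + 3)
  | LevelA j of j < k : level_spec (k + 4 + 3 * j)
  | LevelN j of j < k : level_spec (k + 5 + 3 * j)
  | LevelB j of j < k : level_spec (k + 6 + 3 * j)
  | LevelP j of j < d - 3 : level_spec (4 * k + 4 + 4 * j)
  | LevelU j of j < d - 3 : level_spec (4 * k + 5 + 4 * j)
  | LevelM j of j < d - 3 : level_spec (4 * k + 6 + 4 * j)
  | LevelW j of j < d - 3 : level_spec (4 * k + 7 + 4 * j)
  | LevelTop : level_spec top_level
  | LevelR j of j < d - 1 : level_spec (top_level + 1 + j).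

Lemma levelP l : l < num_levels -> level_spec l.
Proof.
rewrite /num_levels /top_level => lt_l.
have top_eq : top_level = 4 * k + 4 + 4 * (d - 3) by rewrite /top_level; lia.
have [->|l0] := eqVneq l 0; first exact: Level0.
have [le_k|lt_k] := leqP l k; first by apply: LevelV; lia.
have [->|nu] := eqVneq l (k + 1); first exact: LevelU0.
have [->|nm] := eqVneq l (k + 2); first exact: LevelM0.
have [->|nw] := eqVneq l (k + 3); first exact: LevelW0.
have [lt_4k|ge_4k] := ltnP l (4 * k + 4).
  pose j := (l - (k + 4)) %/ 3; have lt_j : j < k by rewrite /j; lia.
  have [|[]] : l = k + 4 + 3 * j \/ l = k + 5 + 3 * j \/ l = k + 6 + 3 * j by rewrite /j; lia.
  - by move=> ->; apply: LevelA.
  - by move=> ->; apply: LevelN.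
  - by move=> ->; apply: LevelB.
have [lt_top|] := ltnP l top_level.
  pose j := (l - (4 * k + 4)) %/ 4; have lt_j : j < d - 3 by rewrite /j; lia.
  have [|[|[]]] : l = 4 * k + 4 + 4 * j \/ l = 4 * k + 5 + 4 * j \/ l = 4 * k + 6 + 4 * j \/
          l = 4 * k + 7 + 4 * j by rewrite /j; lia.
  - by move=> ->; apply: LevelP.
  - by move=> ->; apply: LevelU.
  - by move=> ->; apply: LevelM.
  - by move=> ->; apply: LevelW.
rewrite leq_eqVlt => /orP[/eqP<-|gt_top]; first exact: LevelTop.
have -> : l = top_level + 1 + (l - (top_level + 1)) by lia.
by apply: LevelR; lia.
Qed.

Ltac no_arc :=
  repeat first [ rewrite arc_VN_outl; [|lia] | rewrite arc_VN_outr; [|lia]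
        | rewrite arc_AB_outl; [|lia] | rewrite arc_AB_outr; [|lia]
        | rewrite arc_PR_outl; [|lia] | rewrite arc_PR_outr; [|lia] ].

Lemma sum_level_size1 t :
    {in t, forall l, [/\ l < num_levels, ~~ block_level l & ~~ ladder_level l]} ->
  \sum_(l <- t) level_size l = size t.
Proof.
move=> t1; rewrite -sum1_size; apply: eq_big_seq => l /t1[]; exact: level_size1.
Qed.

Lemma size_iota_neq m n x :
  size [seq i <- iota m n | i != x] = n - (m <= x < m + n).
Proof.
rewrite size_filter (@eq_count _ _ (predC (pred1 x))) //.
have := count_predC (pred1 x) (iota m n).
by rewrite size_iota count_uniq_mem ?iota_uniq // mem_iota; lia.
Qed.

(** The vertices [m] see only their own piece. Besides the degree count, this is what later shows
    that they would be trapped if the edge [ab] were used. *)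
Lemma level_adj_N j b : j < k -> b < num_levels ->
  level_adj (k + 5 + 3 * j) b =
  (b \in [:: k - j; k + 4 + 3 * j; k + 5 + 3 * j; k + 6 + 3 * j]).
Proof.
have top_eq : top_level = 4 * k + 4 + 4 * (d - 3) by rewrite /top_level; lia.
move=> jk b_lt; rewrite !inE /level_adj /level_arc; no_arc.
have -> : arc_VN b (k + 5 + 3 * j) = (b == k - j) by rewrite /arc_VN; lia.
have -> : arc_AB (k + 5 + 3 * j) b = false by rewrite /arc_AB; lia.
have -> : arc_AB b (k + 5 + 3 * j) = false by rewrite /arc_AB; lia.
lia.
Qed.

Lemma level_degree l : l < num_levels ->
  \sum_(0 <= b < num_levels | level_adj l b) level_size b = d + 1.
Proof.
have top_eq : top_level = 4 * k + 4 + 4 * (d - 3) by rewrite /top_level; lia.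
have nlev_eq : num_levels = top_level + d by [].
have sz_R : {in iota (top_level + 1) (d - 1), forall l,
    [/\ l < num_levels, ~~ block_level l & ~~ ladder_level l]}.
  move=> b; rewrite mem_iota => ?.
  by split; rewrite /block_level /ladder_level; lia.
have sum_R : \sum_(l <- iota (top_level + 1) (d - 1)) level_size l = d - 1.
  by rewrite sum_level_size1 // size_iota.
case/levelP=> [|j jk||||j jk|j jk|j jk|j jd|j jd|j jd|j jd||j jd].
- rewrite (@sum_level_adj 0 ([:: 0; 1] ++ iota (top_level + 1) (d - 1))).
  + rewrite big_cat sum_R /= !big_cons big_nil.
    by rewrite !level_size1 // /block_level /ladder_level; lia.
  + rewrite cat_uniq iota_uniq andbT; apply/andP; split; first by rewrite /= ?inE; lia.
    by apply/hasPn => b; rewrite mem_iota /= ?inE; lia.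
  + rewrite all_cat /=; apply/andP; split; first lia.
    by apply/allP => b; rewrite mem_iota /=; lia.
  + move=> b b_lt; rewrite mem_cat mem_iota !inE /level_adj /level_arc; no_arc.
    by rewrite /arc_PR; lia.
- rewrite (@sum_level_adj _ [:: j.-1; j; j.+1; 4 * k + 5 - 3 * j]).
  + rewrite !big_cons big_nil (@level_size_ladder (4 * k + 5 - 3 * j));
      last by rewrite /ladder_level; lia.
    by rewrite !level_size1 // /block_level /ladder_level; lia.
  + by rewrite /= !inE; lia.
  + by rewrite /=; lia.
  + move=> b b_lt; rewrite !inE /level_adj /level_arc; no_arc; rewrite /arc_VN; lia.
- rewrite (@sum_level_adj _ [:: k; k + 1; k + 2]).
  + rewrite !big_cons big_nil (@level_size_block (k + 2)); last by rewrite /block_level; lia.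
    by rewrite !level_size1 // /block_level /ladder_level; lia.
  + by rewrite /= !inE; lia.
  + by rewrite /=; lia.
  + move=> b b_lt; rewrite !inE /level_adj /level_arc; no_arc; lia.
- rewrite (@sum_level_adj _ [:: k + 1; k + 2; k + 3]).
  + rewrite !big_cons big_nil (@level_size_block (k + 2)); last by rewrite /block_level; lia.
    by rewrite !level_size1 // /block_level /ladder_level; lia.
  + by rewrite /= !inE; lia.
  + by rewrite /=; lia.
  + move=> b b_lt; rewrite !inE /level_adj /level_arc; no_arc; lia.
- rewrite (@sum_level_adj _ [:: k + 2; k + 3; k + 4]).
  + rewrite !big_cons big_nil (@level_size_block (k + 2)); last by rewrite /block_level; lia.
    by rewrite !level_size1 // /block_level /ladder_level; lia.
  + by rewrite /= !inE; lia.
  + by rewrite /=; lia.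
  + move=> b b_lt; rewrite !inE /level_adj /level_arc; no_arc; lia.
- rewrite (@sum_level_adj _ [:: k + 3 + 3 * j; k + 4 + 3 * j; k + 5 + 3 * j; k + 6 + 3 * j]).
  + rewrite !big_cons big_nil (@level_size_ladder (k + 5 + 3 * j));
      last by rewrite /ladder_level; lia.
    by rewrite !level_size1 // /block_level /ladder_level; lia.
  + by rewrite /= !inE; lia.
  + by rewrite /=; lia.
  + move=> b b_lt; rewrite !inE /level_adj /level_arc; no_arc.
    have -> : arc_VN b (k + 4 + 3 * j) = false by rewrite /arc_VN; lia.
    have -> : arc_AB (k + 4 + 3 * j) b = (b == k + 6 + 3 * j) by rewrite /arc_AB; lia.
    have -> : arc_AB b (k + 4 + 3 * j) = false by rewrite /arc_AB; lia.
    lia.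
- rewrite (@sum_level_adj _ [:: k - j; k + 4 + 3 * j; k + 5 + 3 * j; k + 6 + 3 * j]).
  + rewrite !big_cons big_nil (@level_size_ladder (k + 5 + 3 * j));
      last by rewrite /ladder_level; lia.
    by rewrite !level_size1 // /block_level /ladder_level; lia.
  + by rewrite /= !inE; lia.
  + by rewrite /=; lia.
  + by move=> b; apply: level_adj_N.
- rewrite (@sum_level_adj _ [:: k + 4 + 3 * j; k + 5 + 3 * j; k + 6 + 3 * j; k + 7 + 3 * j]).
  + rewrite !big_cons big_nil (@level_size_ladder (k + 5 + 3 * j));
      last by rewrite /ladder_level; lia.
    by rewrite !level_size1 // /block_level /ladder_level; lia.
  + by rewrite /= !inE; lia.
  + by rewrite /=; lia.
  + move=> b b_lt; rewrite !inE /level_adj /level_arc; no_arc.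
    have -> : arc_VN b (k + 6 + 3 * j) = false by rewrite /arc_VN; lia.
    have -> : arc_AB b (k + 6 + 3 * j) = (b == k + 4 + 3 * j) by rewrite /arc_AB; lia.
    have -> : arc_AB (k + 6 + 3 * j) b = false by rewrite /arc_AB; lia.
    lia.
(* The vertex here is [p_(j+1)]; the level left out, [top_level + 2 + j], is that of [r_(j+1)]. *)
- rewrite (@sum_level_adj _ ([:: 4 * k + 3 + 4 * j; 4 * k + 4 + 4 * j; 4 * k + 5 + 4 * j] ++
                           [seq b <- iota (top_level + 1) (d - 1) | b != top_level + 2 + j])).
  + rewrite big_cat /= !big_cons big_nil.
    rewrite [X in _ + X]sum_level_size1; last by move=> b; rewrite mem_filter => /andP[_ /sz_R].
    rewrite size_iota_neq !level_size1 // /block_level /ladder_level; lia.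
  + rewrite cat_uniq filter_uniq ?iota_uniq // andbT; apply/andP; split;
      first by rewrite /= ?inE; lia.
    by apply/hasPn => b; rewrite mem_filter mem_iota /= ?inE; lia.
  + rewrite all_cat /=; apply/andP; split; first lia.
    by apply/allP => b; rewrite mem_filter mem_iota /=; lia.
  + move=> b b_lt; rewrite mem_cat mem_filter mem_iota !inE /level_adj /level_arc; no_arc.
    have -> : arc_AB b (4 * k + 4 + 4 * j) = false by rewrite /arc_AB; lia.
    rewrite /arc_PR; lia.
- rewrite (@sum_level_adj _ [:: 4 * k + 4 + 4 * j; 4 * k + 5 + 4 * j; 4 * k + 6 + 4 * j]).
  + rewrite !big_cons big_nil (@level_size_block (4 * k + 6 + 4 * j));
      last by rewrite /block_level; lia.
    by rewrite !level_size1 // /block_level /ladder_level; lia.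
  + by rewrite /= !inE; lia.
  + by rewrite /=; lia.
  + move=> b b_lt; rewrite !inE /level_adj /level_arc; no_arc.
    have -> : arc_AB b (4 * k + 5 + 4 * j) = false by rewrite /arc_AB; lia.
    have -> : arc_PR (4 * k + 5 + 4 * j) b = false by rewrite /arc_PR; lia.
    have -> : arc_PR b (4 * k + 5 + 4 * j) = false by rewrite /arc_PR; lia.
    lia.
- rewrite (@sum_level_adj _ [:: 4 * k + 5 + 4 * j; 4 * k + 6 + 4 * j; 4 * k + 7 + 4 * j]).
  + rewrite !big_cons big_nil (@level_size_block (4 * k + 6 + 4 * j));
      last by rewrite /block_level; lia.
    by rewrite !level_size1 // /block_level /ladder_level; lia.
  + by rewrite /= !inE; lia.
  + by rewrite /=; lia.
  + move=> b b_lt; rewrite !inE /level_adj /level_arc; no_arc.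
    have -> : arc_PR (4 * k + 6 + 4 * j) b = false by rewrite /arc_PR; lia.
    have -> : arc_PR b (4 * k + 6 + 4 * j) = false by rewrite /arc_PR; lia.
    lia.
- rewrite (@sum_level_adj _ [:: 4 * k + 6 + 4 * j; 4 * k + 7 + 4 * j; 4 * k + 8 + 4 * j]).
  + rewrite !big_cons big_nil (@level_size_block (4 * k + 6 + 4 * j));
      last by rewrite /block_level; lia.
    by rewrite !level_size1 // /block_level /ladder_level; lia.
  + by rewrite /= !inE; lia.
  + by rewrite /=; lia.
  + move=> b b_lt; rewrite !inE /level_adj /level_arc; no_arc.
    have -> : arc_PR (4 * k + 7 + 4 * j) b = false by rewrite /arc_PR; lia.
    have -> : arc_PR b (4 * k + 7 + 4 * j) = false by rewrite /arc_PR; lia.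
    lia.
- rewrite (@sum_level_adj _ ([:: top_level - 1; top_level] ++ iota (top_level + 1) (d - 1))).
  + rewrite big_cat sum_R /= !big_cons big_nil.
    by rewrite !level_size1 // /block_level /ladder_level; lia.
  + rewrite cat_uniq iota_uniq andbT; apply/andP; split; first by rewrite /= ?inE; lia.
    by apply/hasPn => b; rewrite mem_iota /= ?inE; lia.
  + rewrite all_cat /=; apply/andP; split; first lia.
    by apply/allP => b; rewrite mem_iota /=; lia.
  + move=> b b_lt; rewrite mem_cat mem_iota !inE /level_adj /level_arc; no_arc.
    by rewrite /arc_PR; lia.
(* For [r_j], [P] collects the [p_i] with [0 < i < d - 2] and [t] the closed neighbourhood on the
   path. An end of the path has one path neighbour fewer but misses no [p_i], so the total is the
   same. *)
- pose P := [seq 4 * k + 4 * i | i <- [seq i <- iota 1 (d - 3) | i != j]].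
  have mem_P b : b < num_levels ->
      (b \in P) = (arc_PR b (top_level + 1 + j) && (b != 0) && (b != top_level)).
    move=> b_lt; apply/mapP/idP => [[i]|].
      by rewrite mem_filter mem_iota /arc_PR => ? ->; lia.
    rewrite /arc_PR => ?; exists ((b - 4 * k) %/ 4); last by lia.
    by rewrite mem_filter mem_iota; lia.
  have P_1 : {in P, forall l, [/\ l < num_levels, ~~ block_level l & ~~ ladder_level l]}.
    move=> b /mapP[i]; rewrite mem_filter mem_iota => ? ->.
    by split; rewrite /block_level /ladder_level; lia.
  pose t := [seq b <- [:: top_level + j; top_level + 1 + j; top_level + 2 + j] |
             (top_level < b) && (b < num_levels)].
  have t_1 : {in t, forall l, [/\ l < num_levels, ~~ block_level l & ~~ ladder_level l]}.
    move=> b; rewrite mem_filter => /andP[? _].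
    by split; rewrite /block_level /ladder_level; lia.
  rewrite (@sum_level_adj _ ([:: 0; top_level] ++ t ++ P)).
  + rewrite !big_cat /= !big_cons big_nil !sum_level_size1 //.
    rewrite size_map size_iota_neq !level_size1 //; try by rewrite /block_level /ladder_level;
      lia.
    by rewrite /t /=; do !case: ifP => ? /=; lia.
  + rewrite 2!cat_uniq; apply/and5P; split; first by rewrite /= !inE; lia.
    * apply/hasPn => b; rewrite mem_cat mem_filter => /orP[/andP[? _]|/mapP[i]];
        first by rewrite /= !inE; lia.
      by rewrite mem_filter mem_iota /= !inE => ? ->; lia.
    * by rewrite filter_uniq //= !inE; lia.
    * apply/hasPn => b /mapP[i]; rewrite mem_filter mem_iota /= mem_filter => ? ->.
      by lia.
    * by rewrite map_inj_uniq ?filter_uniq ?iota_uniq // => i i'; lia.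
  + apply/allP => b; rewrite !mem_cat => /or3P[|/t_1[]|/P_1[]] //=.
    by rewrite !inE; lia.
  + move=> b b_lt; rewrite !mem_cat mem_P // mem_filter !inE /level_adj /level_arc; no_arc.
    have [->|b0] := eqVneq b 0; first by rewrite /arc_PR; lia.
    have [->|bt] := eqVneq b top_level; first by rewrite /arc_PR; lia.
    by rewrite !andbT; case: arc_PR; lia.
Qed.
End LevelGraph.

(** * Forced edges *)

Section LevelCuts.
Context (k d : nat).
Hypothesis hd : 5 <= d.
Local Notation top := (top_level k d).
Local Notation nlev := (num_levels k d).
Local Notation adj := (level_adj k d).

(** When the levels [l1.-1], [l1], [l2], [l2.+1] are singletons, at most two edges leave such an
    interval, one at each end. *)
Definition cut_interval (l1 l2 : nat) : Prop :=
  forall a b, l1 <= a <= l2 -> ~~ (l1 <= b <= l2) -> adj a b ->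
    a = l1 /\ b = l1.-1 \/ a = l2 /\ b = l2.+1.

Let top_eq : top = 4 * k + 4 + 4 * (d - 3).
Proof. by rewrite /top_level; lia. Qed.

(** These intervals are nested, from the first block alone ([j = k]) to the block with the whole
    ladder ([j = 0]). Each contains whole pieces only: [j < a] is equivalent to
    [4 * k + 5 - 3 * a <= 4 * k + 2 - 3 * j], so no arc of a piece crosses the border. *)
Lemma ladder_cut j : j <= k -> cut_interval j.+1 (4 * k + 3 - 3 * j).
Proof.
move=> jk a b a_in b_out; rewrite /level_adj /level_arc.
rewrite arc_PR_outl; last lia. rewrite arc_PR_outr; last lia.
case/or3P => [/eqP eq_ab|/or4P[/eqP|||//]|/or4P[/eqP|||//]]; rewrite /arc_VN /arc_AB; lia.
Qed.

Lemma block_cut j : j < d - 3 -> cut_interval (4 * k + 5 + 4 * j) (4 * k + 7 + 4 * j).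
Proof.
move=> jk a b a_in b_out; rewrite /level_adj /level_arc.
rewrite (@arc_PR_outr k d b a) //; last lia.
case/or3P => [/eqP eq_ab|/or4P[/eqP|||]|/or4P[/eqP|||//]]; rewrite /arc_VN /arc_AB /arc_PR; lia.
Qed.

(** The pairs that a hamiltonian cycle may still use: neighbouring or equal levels, and [p_0] or
    [p_(d-2)] with some [r_j]. *)
Definition near_levels (a b : nat) : bool :=
  [|| (a <= b.+1) && (b <= a.+1),
      ((a == 0) || (a == top)) && (top < b) |
      ((b == 0) || (b == top)) && (top < a)].

Lemma adj_near a b : adj a b ->
  [|| near_levels a b, arc_VN k a b, arc_VN k b a, arc_AB k a b, arc_AB k b a,
      arc_PR k d a b && (4 * k + 4 <= a < top) | arc_PR k d b a && (4 * k + 4 <= b < top)].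
Proof.
rewrite /level_adj /level_arc /near_levels.
case/or3P=> [/eqP->|/or4P[/eqP->|->|->|]|/or4P[/eqP->|->|->|]]; rewrite ?orbT //; try lia.
  by move=> ab; rewrite ab; move: ab; rewrite /arc_PR; lia.
by move=> ab; rewrite ab; move: ab; rewrite /arc_PR; lia.
Qed.
End LevelCuts.

(** * Hamiltonian cycles as cyclic listings, and the edges they must use or avoid *)

Section HamiltonianListing.
Context {V : finType} (s : seq V).
Hypotheses (us : uniq s) (fs : s =i V) (V_gt2 : 2 < #|V|).

Lemma next_inj : injective (next s).
Proof. exact: can_inj (prev_next us). Qed.

Lemma next_closed (S : pred V) x :
  S x -> (forall y, S y -> S (next s y)) -> forall y, S y.
Proof.
move=> Sx clS y; have : fconnect (next s) x y.
  by rewrite (fconnect_cycle (cycle_next us)) ?fs.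
by move/iter_findex <-; elim: findex => //= i; apply: clS.
Qed.

Lemma next_exit (S : pred V) x y : S x -> ~~ S y -> exists2 z, S z & ~~ S (next s z).
Proof.
move=> Sx Sy; apply/exists_inP; apply: contraNT Sy => /exists_inPn cl.
by apply: (next_closed Sx) => z Sz; apply/negPn/cl.
Qed.

Lemma next_next_neq x : next s (next s x) != x.
Proof.
apply/eqP => eq_x; have := @next_closed [pred y in [:: x; next s x]] x.
rewrite /= mem_head => /(_ isT) cl.
suff : #|V| <= 2 by rewrite leqNgt V_gt2.
apply: leq_trans (card_size [:: x; next s x]); apply/subset_leq_card/fintype.subsetP => y _.
by apply: cl => z; rewrite !inE => /orP[]/eqP->; rewrite ?eq_x eqxx ?orbT.
Qed.

Definition consecutive x y := (y == next s x) || (x == next s y).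

Lemma consecutive_sym : symmetric consecutive.
Proof. by move=> x y; rewrite /consecutive orbC. Qed.

Lemma consecutive_two x y z t :
  consecutive x y -> consecutive x z -> y != z -> consecutive x t -> (t == y) || (t == z).
Proof.
have pre a b : x = next s a -> x = next s b -> a = b by move=> ->; apply: next_inj.
case/orP=> /eqP xy /orP[]/eqP xz yz /orP[]/eqP xt.
- by rewrite xy xz eqxx in yz.
- by rewrite xy xz eqxx in yz.
- by rewrite xt xy eqxx.
- by rewrite (pre _ _ xt xz) eqxx orbT.
- by rewrite xt xz eqxx orbT.
- by rewrite (pre _ _ xt xy) eqxx.
- by rewrite (pre _ _ xy xz) eqxx in yz.
- by rewrite (pre _ _ xy xz) eqxx in yz.
Qed.

Context (k d : nat) (lev : V -> nat).
Hypothesis hd : 5 <= d.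
Hypothesis card_lev : forall l, #|[pred x | lev x == l]| = level_size k d l.
Hypothesis adj_next : forall x, level_adj k d (lev x) (lev (next s x)).
Local Notation top := (top_level k d).
Local Notation nlev := (num_levels k d).

(** Supplies the alternation hypothesis of [level_path_nondecreasing]: wide levels are never
    adjacent, and [top] is a singleton. *)
Lemma single_alternate l : l <= top ->
  (level_size k d l == 1) || (l.+1 <= top) && (level_size k d l.+1 == 1).
Proof.
move=> le_l; have [wide|] := boolP (block_level k d l || ladder_level k l); last first.
  by rewrite negb_or => /andP[? ?]; rewrite level_size1 // /num_levels; lia.
have top_eq : top = 4 * k + 4 + 4 * (d - 3) by rewrite /top_level; lia.
have /andP[lt_l narrow] : (l.+1 <= top) && ~~ (block_level k d l.+1 || ladder_level k l.+1).
  by move: wide; rewrite /block_level /ladder_level; lia.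
rewrite negb_or in narrow; have /andP[? ?] := narrow.
by rewrite lt_l (level_size1 (l := l.+1)) ?orbT // /num_levels; lia.
Qed.

Lemma lev_lt x : lev x < nlev.
Proof.
rewrite ltnNge; apply/negP => /level_size_out; rewrite -card_lev => /card0_eq/(_ x).
by rewrite !inE eqxx.
Qed.

Lemma lev_inhabited l : 0 < level_size k d l -> exists x, lev x = l.
Proof. by rewrite -card_lev => /card_gt0P[x]; rewrite inE => /eqP; exists x. Qed.

Lemma lev_single x y : level_size k d (lev x) = 1 -> lev x = lev y -> x = y.
Proof.
rewrite -card_lev => /eqP; rewrite eqn_leq => /andP[/card_le1_eqP le1 _] eq_xy.
by apply: le1; rewrite inE ?eq_xy.
Qed.

Lemma consecutive_adj x y : consecutive x y -> level_adj k d (lev x) (lev y).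
Proof.
case/orP=> /eqP->; first exact: adj_next.
by rewrite level_adj_sym adj_next.
Qed.

(** For singleton levels this says that the edge between them lies on the cycle. *)
Definition linked (a b : nat) : Prop :=
  forall x y, lev x = a -> lev y = b -> consecutive x y.

(* A hamiltonian cycle leaves and enters the interval through different edges. *)
Lemma cut_linked l1 l2 : l1 <= l2 ->
    cut_interval k d l1 l2 ->
    {in [:: l1.-1; l1; l2; l2.+1], forall l, level_size k d l = 1} ->
    0 < l1 ->
  linked l1 l1.-1 /\ linked l2 l2.+1.
Proof.
move=> le12 cut size1 l1_gt0; pose S := [pred x | l1 <= lev x <= l2].
have sz l : l \in [:: l1.-1; l1; l2; l2.+1] -> forall x y, lev x = l -> lev y = l -> x = y.
  by move=> /size1 sz1 x y lx ly; apply: lev_single; rewrite lx.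
have [x1 x1E] : exists x, lev x = l1 by apply: lev_inhabited; rewrite size1 // !inE eqxx ?orbT.
have [x0 x0E] : exists x, lev x = l1.-1 by apply: lev_inhabited; rewrite size1 // !inE eqxx ?orbT.
have Sx1 : S x1 by rewrite /= x1E leqnn.
have Sx0 : ~~ S x0 by rewrite /= x0E; lia.
have link x y : lev x \in [:: l1.-1; l1; l2; l2.+1] -> lev y \in [:: l1.-1; l1; l2; l2.+1] ->
    consecutive x y -> linked (lev x) (lev y).
  by move=> lx ly xy x' y' /(sz _ lx)-/(_ x erefl)-> /(sz _ ly)-/(_ y erefl)->.
have [x Sx Sfx] := next_exit Sx1 Sx0.
have [y Sy Sfy] := @next_exit (predC S) x0 x1 Sx0 (introN negP (fun h => h Sx1)).
have xfx : consecutive x (next s x) by rewrite /consecutive eqxx.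
have fyy : consecutive (next s y) y by rewrite /consecutive eqxx orbT.
have /negPn /= {}Sfy := Sfy.
have := cut _ _ Sx Sfx (adj_next x).
have : level_adj k d (lev (next s y)) (lev y) by rewrite level_adj_sym adj_next.
move=> /(cut _ _ Sfy Sy) [[ly ly']|[ly ly']] [[lx lx']|[lx lx']].
(* Leaving and entering at the same end would use one edge twice and give
   [next s (next s x) = x]. *)
- have eq_x : x = next s y by apply: (sz l1); rewrite ?inE ?eqxx ?orbT.
  have eq_y : next s x = y by apply: (sz l1.-1); rewrite ?inE ?eqxx ?orbT.
  by have := next_next_neq x; rewrite eq_y -eq_x eqxx.
- split; [rewrite -ly' -ly|rewrite -lx' -lx]; apply: link => //; 
  by rewrite ?lx ?lx' ?ly ?ly' !inE eqxx ?orbT.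
- split; [rewrite -lx' -lx|rewrite -ly' -ly]; apply: link => //; 
  by rewrite ?lx ?lx' ?ly ?ly' !inE eqxx ?orbT.
- have eq_x : x = next s y by apply: (sz l2); rewrite ?inE ?eqxx ?orbT.
  have eq_y : next s x = y by apply: (sz l2.+1); rewrite ?inE ?eqxx ?orbT.
  by have := next_next_neq x; rewrite eq_y -eq_x eqxx.
Qed.

Lemma linked_sym a b : linked a b -> linked b a.
Proof. by move=> ab x y ex ey; rewrite consecutive_sym; apply: ab. Qed.

Lemma linked_two l a b x y :
    linked l a -> linked l b -> a != b ->
    0 < level_size k d a -> 0 < level_size k d b ->
  lev x = l -> consecutive x y -> lev y = a \/ lev y = b.
Proof.
move=> la lb ab /lev_inhabited[u ua] /lev_inhabited[v vb] lx xy.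
have uv : u != v by apply: contra ab => /eqP uv; rewrite -ua -vb uv.
by have /orP[/eqP->|/eqP->] := consecutive_two (la _ _ lx ua) (lb _ _ lx vb) uv xy; [left|right].
Qed.

Lemma ladder_linked j : j <= k ->
  linked j.+1 j /\ linked (4 * k + 3 - 3 * j) (4 * k + 4 - 3 * j).
Proof.
move=> jk; have [||l|//|] := @cut_linked j.+1 (4 * k + 3 - 3 * j); first lia.
- exact: ladder_cut.
- rewrite !inE /= => in_l.
  by apply: level_size1; rewrite /num_levels /top_level /block_level /ladder_level; lia.
- by have -> : (4 * k + 3 - 3 * j).+1 = 4 * k + 4 - 3 * j by lia.
Qed.

Lemma block_linked j : j < d - 3 ->
  linked (4 * k + 5 + 4 * j) (4 * k + 4 + 4 * j) /\
  linked (4 * k + 7 + 4 * j) (4 * k + 8 + 4 * j).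
Proof.
move=> jk; have [||l|//|] := @cut_linked (4 * k + 5 + 4 * j) (4 * k + 7 + 4 * j); first lia.
- exact: block_cut.
- rewrite !inE /= => in_l.
  by apply: level_size1; rewrite /num_levels /top_level /block_level /ladder_level; lia.
- lia.
- have -> : (4 * k + 5 + 4 * j).-1 = 4 * k + 4 + 4 * j by lia.
  by have -> : (4 * k + 7 + 4 * j).+1 = 4 * k + 8 + 4 * j by lia.
Qed.

Let top_eq : top = 4 * k + 4 + 4 * (d - 3).
Proof. by rewrite /top_level; lia. Qed.

Let single l : l < nlev -> ~~ block_level k d l -> ~~ ladder_level k l ->
  0 < level_size k d l.
Proof. by move=> *; rewrite level_size1. Qed.

(** Both cycle edges at a [v] are forced, as lower border edges of two successive nested ladder
    intervals. *)
Lemma linked_V j : 0 < j <= k -> linked j j.-1 /\ linked j j.+1.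
Proof.
move=> jk; split; last by apply: linked_sym; have [|lj _] := @ladder_linked j; first lia.
by have [|] := @ladder_linked j.-1; first lia; have -> : j.-1.+1 = j by lia.
Qed.

(** [p_(j+1)] sits between two separated intervals, the lower one being the block before it or, for
    [j = 0], the whole ladder. *)
Lemma linked_P j : j < d - 3 ->
  linked (4 * k + 4 + 4 * j) (4 * k + 3 + 4 * j) /\
  linked (4 * k + 4 + 4 * j) (4 * k + 5 + 4 * j).
Proof.
move=> jd; split; last by apply: linked_sym; case: (block_linked jd).
apply: linked_sym; case: j jd => [|j] jd.
  by rewrite muln0 !addn0; have [//|_] := @ladder_linked 0; rewrite !muln0 !subn0.
have [|_] := @block_linked j; first lia.
have -> : 4 * k + 3 + 4 * j.+1 = 4 * k + 7 + 4 * j by lia.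
by have -> : 4 * k + 4 + 4 * j.+1 = 4 * k + 8 + 4 * j by lia.
Qed.

Lemma linked_A j : j < k -> linked (k + 4 + 3 * j) (k + 3 + 3 * j).
Proof.
move=> jk; have [|_] := @ladder_linked (k - j); first lia.
have -> : 4 * k + 3 - 3 * (k - j) = k + 3 + 3 * j by lia.
have -> : 4 * k + 4 - 3 * (k - j) = k + 4 + 3 * j by lia.
exact: linked_sym.
Qed.

Lemma linked_B j : j < k -> linked (k + 6 + 3 * j) (k + 7 + 3 * j).
Proof.
move=> jk; have [|_] := @ladder_linked (k - j.+1); first lia.
have -> : 4 * k + 3 - 3 * (k - j.+1) = k + 6 + 3 * j by lia.
by have -> : 4 * k + 4 - 3 * (k - j.+1) = k + 7 + 3 * j by lia.
Qed.

Lemma not_consecutive_VN x y : arc_VN k (lev x) (lev y) -> ~~ consecutive x y.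
Proof.
rewrite /arc_VN => xy; apply/negP => cxy.
have [|l1 l2] := @linked_V (lev x); first lia.
have [||||] := linked_two l1 l2 _ _ _ erefl cxy; try lia.
  by apply: single; rewrite /num_levels /block_level /ladder_level; lia.
by apply: single; rewrite /num_levels /block_level /ladder_level; lia.
Qed.

Lemma not_consecutive_PR x y :
  arc_PR k d (lev x) (lev y) -> 4 * k + 4 <= lev x < top -> ~~ consecutive x y.
Proof.
rewrite /arc_PR => xy x_in; apply/negP => cxy.
pose j := (lev x - (4 * k + 4)) %/ 4.
have xE : lev x = 4 * k + 4 + 4 * j by rewrite /j; lia.
have jd : j < d - 3 by lia.
have [l1 l2] := linked_P jd.
have [||||] := linked_two l1 l2 _ _ _ xE cxy; try lia.
  by apply: single; rewrite /num_levels /block_level /ladder_level; lia.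
by apply: single; rewrite /num_levels /block_level /ladder_level; lia.
Qed.

(* Otherwise the inner vertices of a ladder piece would have no way out. *)
Lemma not_consecutive_AB x y : arc_AB k (lev x) (lev y) -> ~~ consecutive x y.
Proof.
rewrite /arc_AB => xy; apply/negP => cxy.
pose j := (lev x - (k + 4)) %/ 3.
have xE : lev x = k + 4 + 3 * j by rewrite /j; lia.
have yE : lev y = k + 6 + 3 * j by lia.
have jk : j < k by lia.
have [u uE] : exists u, lev u = k + 3 + 3 * j.
  by apply/lev_inhabited/single; rewrite /num_levels /block_level /ladder_level; lia.
have [v vE] : exists v, lev v = k + 7 + 3 * j.
  by apply/lev_inhabited/single; rewrite /num_levels /block_level /ladder_level; lia.
have [z zE] : exists z, lev z = k + 5 + 3 * j.
  by apply: lev_inhabited; rewrite level_size_ladder /ladder_level; lia.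
have cxu := linked_A jk xE uE; have cyv := linked_B jk yE vE.
(* With [ab] on the cycle, the two cycle edges at each of [v], [a] and [b] avoid the [m]; the level
   of the [m] is then closed under [next s] and would contain every vertex. *)
suff /(_ x) : forall t, lev t == k + 5 + 3 * j by lia.
apply: (@next_closed (fun t => lev t == _) z) => [|t /eqP tE]; first exact/eqP.
have ctt : consecutive t (next s t) by rewrite /consecutive eqxx.
have := adj_next t; rewrite tE level_adj_N ?lev_lt // !inE.
case/or4P => [/eqP eq_t|/eqP eq_t|//|/eqP eq_t].
- have : arc_VN k (lev (next s t)) (lev t) by rewrite /arc_VN; lia.
  by move/not_consecutive_VN; rewrite consecutive_sym ctt.
- have eq_x : next s t = x by apply: lev_single; rewrite ?level_size1 ?eq_t ?xE // /num_levels
    /block_level /ladder_level; lia.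
  rewrite eq_x consecutive_sym in ctt.
  have yu : y != u by apply/eqP => yu; rewrite -yu in uE; lia.
  by have /orP[/eqP tt|/eqP tt] := consecutive_two cxy cxu yu ctt; rewrite tt in tE; lia.
- have eq_y : next s t = y by apply: lev_single; rewrite ?level_size1 ?eq_t ?yE // /num_levels
    /block_level /ladder_level; lia.
  rewrite eq_y consecutive_sym in ctt; rewrite consecutive_sym in cxy.
  have xv : x != v by apply/eqP => xv; rewrite -xv in vE; lia.
  by have /orP[/eqP tt|/eqP tt] := consecutive_two cxy cyv xv ctt; rewrite tt in tE; lia.
Qed.

Lemma consecutive_near x y : consecutive x y -> near_levels k d (lev x) (lev y).
Proof.
move=> cxy; have cyx : consecutive y x by rewrite consecutive_sym.
have := adj_near hd (consecutive_adj cxy).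
case/or4P => [//|/not_consecutive_VN|/not_consecutive_VN|]; rewrite ?cxy ?cyx //.
case/or4P => [/not_consecutive_AB|/not_consecutive_AB|/andP[]|/andP[]]; rewrite ?cxy ?cyx //.
  by move=> /not_consecutive_PR H /H; rewrite cxy.
by move=> /not_consecutive_PR H /H; rewrite cyx.
Qed.

(* The cycle may run through the [r_j] in decreasing order. *)
Definition flip_top (l : nat) : nat := if l <= top then l else top + nlev - l.

(** Levels capped at [top.+1] cannot decrease along the listing, so the [r_j] come last. Among them
    the levels move by unit steps without repetition, hence monotonically, which leaves the two
    directions. *)
Lemma listing_sorted x0 q :
    s = x0 :: q -> lev x0 = 0 -> lev (next s x0) = 1 ->
  sorted (relpre lev leq) s \/ sorted (relpre (flip_top \o lev) leq) s.
Proof.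
move=> sE x0E x1E; pose nths := nth x0 s.
have size_s : size s = #|V| by rewrite -(card_uniqP us); apply: eq_card.
have s_gt2 : 2 < size s by rewrite size_s.
have s_gt0 : 0 < size s by apply: ltn_trans s_gt2.
have lt_last : (size s).-1 < size s by rewrite prednK ?(ltn_trans _ s_gt2).
have next_nths i : i.+1 < size s -> next s (nths i) = nths i.+1.
  move=> lt_i; rewrite next_nth mem_nth 1?ltnW // index_uniq 1?ltnW //.
  by rewrite /nths sE.
have single_R x y : top < lev x -> lev x = lev y -> x = y.
  move=> gt_x; apply: lev_single; have := lev_lt x.
  by move=> ?; apply: level_size1; rewrite // /block_level /ladder_level; lia.
have single0 x : lev x = 0 -> x = x0.
  by move=> ex; apply: lev_single; rewrite ex // level_size1 // /num_levels /block_level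
    /ladder_level; lia.
have neq_nths i j : i < size s -> j < size s -> nths i = nths j -> i = j.
  by move=> lt_i lt_j /eqP; rewrite nth_uniq // => /eqP.
have nths0 : nths 0 = x0 by rewrite /nths sE.
have next_last : next s (nths (size s).-1) = x0.
  rewrite next_nth mem_nth // index_uniq // /nths {1}sE /= nth_default //.
  by rewrite sE.
(* A cycle neighbour of [x0] has level 0, level 1 or a level above [top]; the first two are taken by
   [x0] and its successor. *)
have last_top : top < lev (nths (size s).-1).
  have := @consecutive_near (nths (size s).-1) x0.
  rewrite /consecutive next_last eqxx => /(_ isT); rewrite /near_levels x0E.
  have [/single0|] := eqVneq (lev (nths (size s).-1)) 0.
    by rewrite -nths0 => /neq_nths; lia.
  have [e1|] := eqVneq (lev (nths (size s).-1)) 1; last by rewrite /top_level; lia.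
  have : nths (size s).-1 = nths 1.
    apply: lev_single; rewrite -?next_nths ?nths0 ?e1 ?x1E //; try lia.
    by apply: level_size1; rewrite /num_levels /block_level /ladder_level; lia.
  by move/neq_nths; lia.
(* Capping turns the jump from [p_(d-2)] to any [r_j] into a unit step. The capped level [top.+1]
   holds all the [r_j], so only levels up to [top] count as single below. *)
pose g x := minn (lev x) top.+1.
have step_near i : i.+1 < size s -> near_levels k d (lev (nths i)) (lev (nths i.+1)).
  by move=> lt_i; apply: consecutive_near; rewrite -next_nths // /consecutive eqxx.
have g_sorted : sorted (relpre g leq) s.
  apply/(sortedP x0) => i lt_i.
  apply: (@level_path_nondecreasing _ g x0 s top.+1
            (fun l => (l <= top) && (level_size k d l == 1))) => //.
  - by rewrite -/(nths 0) nths0 /g x0E.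
  - exact/minn_idPr.
  - by move=> j _; rewrite /g; lia.
  - move=> j lt_j; rewrite -/(nths j) -/(nths j.+1) /g.
    have := step_near j lt_j; rewrite /near_levels.
    have [/single0|lj0] := eqVneq (lev (nths j)) 0.
      rewrite -nths0 => /(neq_nths _ _ (ltnW lt_j) s_gt0) j0; rewrite j0 in lt_j *.
      by rewrite -(next_nths 0) // nths0 x0E x1E; lia.
    have [/single0|] := eqVneq (lev (nths j.+1)) 0; last by lia.
    by rewrite -nths0 => /(neq_nths _ _ lt_j s_gt0).
  - move=> x y /andP[le_x /eqP sz_x] eq_xy.
    have [eq_x eq_y] : g x = lev x /\ g x = lev y by move: le_x eq_xy; rewrite /g; lia.
    by apply: lev_single; rewrite -eq_x.
  - move=> l lt_l.
    have le_l : l <= top := lt_l.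
    by rewrite le_l; apply: single_alternate.
have g_mono i j : i <= j -> j < size s -> g (nths i) <= g (nths j).
  move=> le_ij lt_j; apply: (sorted_leq_nth (leT := relpre g leq)) => //.
  - by move=> x y z; apply: leq_trans.
  - by move=> x /=.
  - by rewrite inE (leq_ltn_trans le_ij).
(* [a] is the position of the first [r_j]; from there on only [r_j] occur. *)
pose a := find (fun x => top < lev x) s.
have lt_a : a < size s by rewrite -has_find; apply/hasP; exists (nths (size s).-1);
  rewrite ?mem_nth.
have before_a i : i < a -> lev (nths i) <= top.
  by move/(before_find x0); rewrite -/(nths i); lia.
have after_a i : a <= i -> i < size s -> top < lev (nths i).
  move=> le_ai lt_i; have := g_mono a i le_ai lt_i.
  have : top < lev (nths a) by apply: (nth_find x0 (a := fun x => top < lev x)); rewrite has_find.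
  by rewrite /g; lia.
have [i|i le_ai lt_i eq_i|up|down] := @unit_steps_monotone (lev \o nths) a (size s).-1.
- move=> i_in /=; have := step_near i; have := after_a i; have := after_a i.+1.
  have : lev (nths i) <> lev (nths i.+1).
    by move/single_R => /(_ (after_a i _ _))/neq_nths; lia.
  by rewrite /near_levels; lia.
- have : nths i = nths i.+2 by apply: single_R => //; apply: after_a => //; lia.
  by move/neq_nths; lia.
- left; apply/(sortedP x0) => i lt_i /=; rewrite -/(nths i) -/(nths i.+1).
  have [le_ai|lt_ia] := leqP a i; first by apply: up; lia.
  have := g_mono i i.+1 (leqnSn i) lt_i; have := before_a i lt_ia.
  by rewrite /g; lia.
- right; apply/(sortedP x0) => i lt_i /=; rewrite -/(nths i) -/(nths i.+1) /flip_top.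
  have [le_ai|lt_ia] := leqP a i.
    have gt_i := after_a i le_ai (ltnW lt_i).
    have gt_i1 := after_a i.+1 (leqW le_ai) lt_i.
    rewrite [lev (nths i) <= top]leqNgt gt_i [lev (nths i.+1) <= top]leqNgt gt_i1 /=.
    by apply/leq_sub2l/down; lia.
  have := g_mono i i.+1 (leqnSn i) lt_i; have le_i := before_a i lt_ia.
  have lt_lev := lev_lt (nths i.+1).
  by rewrite le_i /g; case: (leqP (lev (nths i.+1)) top) => lt_i1; clear -le_i lt_lev lt_i1; lia.
Qed.
End HamiltonianListing.

(** * The numerical comparison *)

Lemma succ_exp_le m : 3 <= m -> m.+1 ^ m <= m ^ m.+1.
Proof.
elim: m => // m IHm; rewrite leq_eqVlt => /orP[/eqP<-//|m3].
have m_gt0 : 0 < m by lia.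
have pos : 0 < m ^ m.+1 by rewrite expn_gt0 m_gt0.
(* The factor [m ^ m.+1] allows the use of [m * m.+2 <= m.+1 * m.+1]; what remains is the induction
   hypothesis. *)
rewrite -(leq_pmul2r pos) -expnMn.
apply: (@leq_trans ((m.+1 * m.+1) ^ m.+1)); first by rewrite leq_exp2r //; nia.
rewrite expnMn (expnSr _ m.+1) -mulnA leq_mul2l [X in X <= _]expnS leq_mul2l IHm ?orbT //.
Qed.

(** The right side gains a factor [m.+1 ^ 2], so the induction step reduces to [succ_exp_le]. The
    inequality fails at [m = 6]. *)
Lemma exp_le_fact_sqr m : 7 <= m -> 2 * m ^ m.+1 <= m`! ^ 2.
Proof.
elim: m => // m IHm; rewrite leq_eqVlt => /orP[/eqP<-|m7].
  by rewrite !factS fact0; lia.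
rewrite factS expnMn (expnS _ m.+1) (expnS _ m) [m.+1 * (_ * _)]mulnA mulnn mulnCA.
rewrite leq_mul2l expn_eq0 /=; apply: leq_trans (IHm _); last lia.
by rewrite leq_mul2l succ_exp_le //; lia.
Qed.

(** With [m = d - 1], this is what remains of the strict inequality once both sides are raised to
    the power [d + 1] and common factors are cancelled. *)
Lemma exp_lt_fact_exp m : 4 <= m ->
  2 ^ (m + 2) * m ^ ((m - 3) * (m + 2)) < (m.-1)`! ^ (2 * m).
Proof.
(* The values 4, 5 and 6 lie below the range of [exp_le_fact_sqr] and are computed. *)
rewrite leq_eqVlt => /orP[/eqP<-|].
  have -> : (4.-1)`! = 6 by [].
  have -> : (4 - 3) * (4 + 2) = 6 by [].
  have -> : 4 + 2 = 6 by [].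
  have -> : 2 * 4 = 8 by [].
  lia.
rewrite leq_eqVlt => /orP[/eqP<-|].
  have -> : (5.-1)`! = 24 by [].
  have -> : (5 - 3) * (5 + 2) = 14 by [].
  have -> : 5 + 2 = 7 by [].
  have -> : 2 * 5 = 10 by [].
  lia.
rewrite leq_eqVlt => /orP[/eqP<-|m7].
  have -> : (6.-1)`! = 120 by [].
  have -> : (6 - 3) * (6 + 2) = 24 by [].
  have -> : 6 + 2 = 8 by [].
  have -> : 2 * 6 = 12 by [].
  lia.
have m_gt0 : 0 < m by lia.
have eq_m : m`! = m * (m.-1)`! by rewrite -{1}(prednK m_gt0) factS prednK.
have pos : 0 < m ^ (2 * m) by rewrite expn_gt0 m_gt0.
rewrite -(ltn_pmul2l pos) -expnMn -eq_m (expnM m`!).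
apply: (@leq_trans ((2 * m ^ m.+1) ^ m)); last by rewrite leq_exp2r // exp_le_fact_sqr.
rewrite mulnCA -expnD expnMn -expnM expnD -mulnA ltn_pmul2l ?expn_gt0 //.
have -> : m.+1 * m = 6 + (2 * m + (m - 3) * (m + 2)) by nia.
rewrite (expnD _ 6) ltn_pmul2r ?expn_gt0 ?m_gt0 //.
by apply: leq_trans (leq_pexp2l m_gt0 (_ : 2 <= 6)) => //; nia.
Qed.

(** * The graph and its hamiltonian cycles *)

Section EdgesOf.
Context {V : finType}.
Implicit Types (e : rel V) (s : seq V).

Definition edges_of e : {set {set V}} :=
  [set A | [exists x, exists y, [&& x != y, e x y & A == [set x; y]]]].

Lemma set2_injr (x y z : V) : x != y -> [set x; y] = [set x; z] -> y = z.
Proof.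
move=> xy eq_xyz; have : y \in [set x; z] by rewrite -eq_xyz set22.
by rewrite in_set2 eq_sym (negPf xy) => /eqP.
Qed.

Lemma edges_of_set2 e x y : symmetric e -> ([set x; y] \in edges_of e) = (x != y) && e x y.
Proof.
move=> sym_e; rewrite inE; apply/existsP/andP =>
  [[u /existsP[v /and3P[uv euv /eqP eq_uv]]]|[xy exy]].
  have : x \in [set u; v] by rewrite -eq_uv set21.
  rewrite in_set2 => /orP[]/eqP eq_x; rewrite eq_x in eq_uv *.
    by rewrite -(set2_injr uv (esym eq_uv)) uv.
  rewrite (finset.setUC [set u]) in eq_uv; rewrite eq_sym in uv.
  by rewrite -(set2_injr uv (esym eq_uv)) uv sym_e.
by exists x; apply/existsP; exists y; rewrite xy exy eqxx.
Qed.

Lemma simple_edges_of e : simple_graph (edges_of e).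
Proof.
apply/forall_inP => A; rewrite inE => /existsP[x /existsP[y /and3P[xy _ /eqP->]]].
by rewrite cards2 xy.
Qed.

Lemma degree_edges_of e x : symmetric e ->
  degree (edges_of e) x = #|[pred y | (x != y) && e x y]|.
Proof.
move=> sym_e; rewrite /degree -(@card_in_imset _ _ (fun y => [set x; y])); last first.
  by move=> y z /andP[xy _] _; apply: set2_injr.
apply: eq_card => A; rewrite inE; apply/andP/imsetP => [[eA xA]|[y]]; last first.
  by rewrite inE => xy ->; rewrite edges_of_set2 ?set21.
move: (eA); rewrite inE => /existsP[u /existsP[v /and3P[uv euv /eqP defA]]].
move: xA; rewrite defA in_set2 => /orP[]/eqP->; first by exists v; rewrite ?inE ?uv.
by exists u; rewrite ?inE 1?eq_sym ?uv 1?sym_e // finset.setUC.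
Qed.

(** Together with reversal, this lets a listing of a given cycle start at level 0 and continue to
    level 1. *)
Lemma cycle_edges_rot i s : uniq s -> cycle_edges (rot i s) = cycle_edges s.
Proof.
move=> us; apply/setP => A; apply/imsetP/imsetP => -[x];
  rewrite ?mem_rot => xs ->; exists x; rewrite ?mem_rot //= next_rot //.
Qed.

Lemma cycle_edges_rev s : uniq s -> cycle_edges (rev s) = cycle_edges s.
Proof.
move=> us; apply/setP => A; apply/imsetP/imsetP => -[x].
  rewrite mem_rev => xs ->; exists (prev s x); rewrite ?mem_prev //.
  by rewrite next_rev // next_prev // finset.setUC.
move=> xs ->; exists (next s x); rewrite ?mem_rev ?mem_next //.
by rewrite next_rev // prev_next // finset.setUC.
Qed.

End EdgesOf.

(** * The graph defined by the levels: regularity, hamiltonicity and the count of cycles *)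

Section LevelledGraph.
Context {V : finType} (k d : nat) (lev : V -> nat).
Hypothesis hd : 5 <= d.
Hypothesis card_lev : forall l, #|[pred x | lev x == l]| = level_size k d l.
Local Notation top := (top_level k d).
Local Notation nlev := (num_levels k d).

Definition level_graph : {set {set V}} :=
  edges_of (fun x y => level_adj k d (lev x) (lev y)).

Let level_adj_lev_sym : symmetric (fun x y => level_adj k d (lev x) (lev y)).
Proof. by move=> x y; rewrite /= level_adj_sym. Qed.

Lemma regular_level_graph : regular d level_graph.
Proof.
apply/forallP => x; rewrite degree_edges_of //.
have x_lt : lev x < nlev by apply: lev_lt card_lev x.
have := level_degree hd x_lt.
have -> : \sum_(0 <= b < nlev | level_adj k d (lev x) b) level_size k d b =
          #|[pred y | level_adj k d (lev x) (lev y)]|.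
  rewrite -sum1_card big_mkord (partition_big (fun y => Ordinal (lev_lt card_lev y))
    (fun b : 'I__ => level_adj k d (lev x) b)) //=.
  apply: eq_bigr => b adj_b; rewrite -card_lev -sum1_card; apply: eq_bigl => y.
  by rewrite !inE -val_eqE /=; case: eqP => [->|]; rewrite ?adj_b ?andbF.
(* The level count includes [x] itself, which is removed here. *)
rewrite (cardD1 x) inE /level_adj eqxx /= add1n addn1 => -[card_d].
by apply/eqP; rewrite -[RHS]card_d; apply: eq_card => y; rewrite !inE eq_sym.
Qed.

Lemma card_gt2 : 2 < #|V|.
Proof.
apply: (@leq_trans (level_size k d (k + 2))).
  by rewrite level_size_block // /block_level; lia.
by rewrite -card_lev max_card.
Qed.

Lemma uniq_full (s : seq V) : uniq s -> size s = #|V| -> s =i V.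
Proof.
move=> us size_s; apply/subset_cardP; last exact: subset_predT.
by rewrite (card_uniqP us) size_s; apply: eq_card.
Qed.

Lemma level_graph_cycle (s : seq V) (C : {set {set V}}) :
    uniq s -> s =i V -> C = cycle_edges s ->
  (C \subset level_graph) = [forall x, level_adj k d (lev x) (lev (next s x))].
Proof.
move=> us fs ->; apply/fintype.subsetP/forallP => [sub x|adj A].
  have := sub [set x; next s x]; rewrite edges_of_set2 //.
  move/(_ _)/andP => [|_ //].
  by apply/imsetP; exists x; rewrite ?fs.
case/imsetP => x _ ->; rewrite edges_of_set2 // adj andbT.
apply/eqP => eq_x; have := next_next_neq us fs card_gt2 x.
by rewrite -eq_x -eq_x eqxx.
Qed.

(** List the vertices by increasing level. No level is empty, so successive levels differ by at most
    one, and the edge from the last [r_j] to [p_0] closes the cycle. *)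
Lemma level_graph_hamiltonian : hamiltonian level_graph.
Proof.
pose s := sort (relpre lev leq) (enum V).
have us : uniq s by rewrite sort_uniq enum_uniq.
have fs : s =i V by move=> x; rewrite mem_sort mem_enum.
have size_s : size s = #|V| by rewrite size_sort -cardE.
have s_gt2 : 2 < size s by rewrite size_s card_gt2.
have [x0 x0E] : exists x, lev x = 0.
  apply: (lev_inhabited card_lev); rewrite level_size1 //;
  by rewrite /num_levels /block_level /ladder_level; lia.
pose nths := nth x0 s.
have mono i j : i <= j -> j < size s -> lev (nths i) <= lev (nths j).
  move=> le_ij lt_j; apply: (sorted_leq_nth (leT := relpre lev leq)) => //.
  - by move=> x y z; apply: leq_trans.
  - by move=> x /=.
  - by apply: sort_sorted => x y /=; apply: leq_total.
  - by rewrite inE (leq_ltn_trans le_ij).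
have inh l : l < nlev -> exists2 j, j < size s & lev (nths j) = l.
  move=> l_lt; have [|y <-] := @lev_inhabited _ _ _ _ card_lev l.
    rewrite /level_size [nlev <= l]leqNgt l_lt /=.
    by case: ifP => _; [lia | case: ifP => _; lia].
  by exists (index y s); rewrite ?index_mem ?fs // /nths nth_index ?fs.
have succ i : i.+1 < size s -> lev (nths i.+1) <= (lev (nths i)).+1.
  move=> lt_i; rewrite leqNgt; apply/negP => gap.
  have [|j lt_j eq_j] := inh (lev (nths i)).+1.
    by apply: leq_trans gap _; apply/ltnW/(lev_lt card_lev).
  have [le_ji|lt_ij] := leqP j i.
    by have := mono j i le_ji (ltnW lt_i); rewrite eq_j ltnn.
  by have := mono i.+1 j lt_ij lt_j; rewrite eq_j leqNgt gap.
have lt_last : (size s).-1 < size s by rewrite prednK ?(ltn_trans _ s_gt2).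
have last_lev : lev (nths (size s).-1) = nlev.-1.
  have [|j lt_j eq_j] := inh nlev.-1; first by rewrite /num_levels; lia.
  have := mono j (size s).-1; rewrite eq_j => /(_ _ lt_last).
  by have := lev_lt card_lev (nths (size s).-1); lia.
have head_lev : lev (nths 0) = 0.
  have [|j lt_j eq_j] := inh 0; first by rewrite /num_levels; lia.
  by have := mono 0 j; rewrite eq_j => /(_ _ lt_j); lia.
have nextE : forall x, level_adj k d (lev x) (lev (next s x)).
  move=> x; have xs : x \in s by rewrite fs.
  pose i := index x s; have lt_i : i < size s by rewrite index_mem.
  have -> : next s x = nths (if i.+1 < size s then i.+1 else 0).
    rewrite next_nth xs -/i /nths; case: (s) lt_i => //= y q lt_i.
    case: ifP => [lt_iq|/negbT]; first by apply: set_nth_default.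
    by rewrite -leqNgt ltnS => le_qi; rewrite nth_default.
  rewrite -{1}(nth_index x0 xs) -/i -/(nths i); case: ifP => [lt_i1|/negbT].
    have := mono i i.+1 (leqnSn i) lt_i1; have := succ i lt_i1.
    rewrite /level_adj /level_arc; lia.
  rewrite -leqNgt => ge_i; have -> : i = (size s).-1 by lia.
  rewrite last_lev head_lev /level_adj /level_arc.
  suff -> : arc_PR k d 0 nlev.-1 by rewrite !orbT.
  by rewrite /arc_PR /num_levels; lia.
apply/existsP; exists (cycle_edges s); rewrite /hamiltonian_cycle card_gt2 /=.
rewrite (level_graph_cycle us fs erefl); apply/andP; split; first exact/forallP.
have size_sb : size s == #|V| by rewrite size_s.
by apply/existsP; exists (Tuple size_sb); rewrite /= us eqxx.
Qed.

Let rotated (s : seq V) x0 :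
    uniq s -> s =i V -> (forall x, level_adj k d (lev x) (lev (next s x))) ->
    lev x0 = 0 -> lev (next s x0) = 1 ->
  exists s', [/\ uniq s', s' =i V, cycle_edges s' = cycle_edges s &
     sorted (relpre lev leq) s' \/ sorted (relpre (flip_top k d \o lev) leq) s'].
Proof.
move=> us fs nextE x0E x1E; have x0s : x0 \in s by rewrite fs.
have [i q rot_s] := rot_to x0s.
have ur : uniq (rot i s) by rewrite rot_uniq.
have fr : rot i s =i V by move=> x; rewrite mem_rot fs.
exists (rot i s); split=> //; first exact: cycle_edges_rot.
apply: (listing_sorted ur fr card_gt2 hd card_lev _ rot_s x0E).
  by move=> x; rewrite next_rot.
by rewrite next_rot.
Qed.

(** The edge between levels 0 and 1 is forced. Reversing the listing if necessary and rotating it to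
    [x0] meets the hypotheses of [listing_sorted]. *)
Lemma hamiltonian_cycle_listing (C : {set {set V}}) :
    hamiltonian_cycle level_graph C ->
  exists s, [/\ uniq s, s =i V, cycle_edges s = C &
     sorted (relpre lev leq) s \/ sorted (relpre (flip_top k d \o lev) leq) s].
Proof.
case/and3P=> _ sub /existsP[s /andP[us /eqP CE]].
have fs : s =i V by apply: uniq_full; rewrite ?size_tuple.
move: sub; rewrite (level_graph_cycle us fs CE) => /forallP nextE; rewrite CE.
have inh l : l < 2 -> exists x, lev x = l.
  move=> l_lt; apply: (lev_inhabited card_lev); rewrite level_size1 //;
  by rewrite /num_levels /block_level /ladder_level; lia.
have [x0 x0E] := inh 0 isT; have [x1 x1E] := inh 1 isT.
have [|link _] := @ladder_linked _ _ us fs card_gt2 _ _ _ hd card_lev nextE 0; first by [].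
have /orP[/eqP eq_x|/eqP eq_x] := link _ _ x1E x0E; last by apply: (rotated us fs nextE x0E);
  rewrite -eq_x.
have prevE x : next (rev s) x = prev s x by rewrite next_rev.
have ur : uniq (rev s) by rewrite rev_uniq.
have fr : rev s =i V by move=> x; rewrite mem_rev fs.
have nextEr x : level_adj k d (lev x) (lev (next (rev s) x)).
  by rewrite prevE level_adj_sym -{2}(next_prev us x).
have x1Er : lev (next (rev s) x0) = 1 by rewrite prevE eq_x prev_next.
by have := rotated ur fr nextEr x0E x1Er; rewrite cycle_edges_rev.
Qed.

Lemma flip_top_lt l : l < nlev -> flip_top k d l < nlev.
Proof. by rewrite /flip_top; case: (leqP l top) => // ? ?; lia. Qed.

Lemma flip_topK l : l < nlev -> flip_top k d (flip_top k d l) = l.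
Proof.
rewrite /flip_top => l_lt; case: (leqP l top) => [-> //|gt_l].
by rewrite ifN; lia.
Qed.

Lemma level_size_flip l : l < nlev -> level_size k d (flip_top k d l) = level_size k d l.
Proof.
rewrite /flip_top => l_lt; case: (leqP l top) => // gt_l.
have top_ge : 4 * k + 4 <= top by rewrite /top_level; lia.
by rewrite !level_size1 // /block_level /ladder_level; lia.
Qed.

(** The factor 2 stands for the two directions along the path of the [r_j]; for each, the listings
    are counted by the factorials of the level sizes. *)
Lemma num_level_graph_cycles :
  num_hamiltonian_cycles level_graph <= 2 * (d - 1)`! ^ (d - 2) * (d - 2)`! ^ k.
Proof.
pose L g := sorted_listings (g \o lev) (iota 0 nlev).
have size_L g : {in gtn nlev, forall l, #|[pred x | g (lev x) == l]| = level_size k d l} ->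
    size (L g) = (d - 1)`! ^ (d - 2) * (d - 2)`! ^ k.
  move=> card_g; rewrite size_sorted_listings -(prod_level_size k hd) /index_iota subn0.
  apply: eq_big_seq => l; rewrite mem_iota => l_lt; congr factorial.
  by rewrite -card_g.
pose cycles := [seq cycle_edges s | s <- L id ++ L (flip_top k d)].
have size_cycles : size cycles = 2 * (d - 1)`! ^ (d - 2) * (d - 2)`! ^ k.
  rewrite size_map size_cat !size_L ?addnn ?mul2n ?doubleMl // => l l_lt.
  rewrite -(level_size_flip l_lt) -card_lev; apply: eq_card => x; rewrite !inE.
  by apply/eqP/eqP => [<-|->]; rewrite flip_topK // (lev_lt card_lev).
rewrite -size_cycles; apply: leq_trans (card_size cycles).
apply/subset_leq_card/fintype.subsetP => C; rewrite inE =>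
  /hamiltonian_cycle_listing[s [us fs <- sorted_s]].
apply: map_f; rewrite mem_cat; case: sorted_s => sorted_s; apply/orP; [left|right];
  apply: sorted_listingsP => // x /=; first exact: lev_lt card_lev x.
exact/flip_top_lt/(lev_lt card_lev).
Qed.

End LevelledGraph.

(** The power [d + 1] clears the fractional exponent in [f] and leaves an inequality between natural
    numbers. *)
Lemma bound_exp_lt (k d : nat) : (5 <= d)%N ->
  ((2 * (d - 1)`! ^ (d - 2) * (d - 2)`! ^ k) ^ (d + 1) <
   (d - 1) ^ (2 * (d + 1)) * (d - 2)`! ^ (d ^ 2 + d - 4 + (d + 1) * k))%N.
Proof.
move=> hd; have {d hd}[e ->] : exists e, d = (e + 5)%N by exists (d - 5)%N; lia.
have -> : (e + 5 - 1 = e + 4)%N by lia.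
have -> : (e + 5 - 2 = e + 3)%N by lia.
have -> : (e + 5 + 1 = e + 6)%N by lia.
(* In terms of [d] the order is [2 (d - 1) + (d - 2) (d + 1) + k (d + 1)]; the last two summands
   match the powers of [q] on the left side. *)
have -> : ((e + 5) ^ 2 + (e + 5) - 4 + (e + 6) * k =
           2 * (e + 4) + ((e + 3) * (e + 6) + k * (e + 6)))%N by nia.
have -> : ((e + 4)`! = (e + 4) * (e + 3)`!)%N by rewrite addnS factS.
have := @exp_lt_fact_exp (e + 4); rewrite (_ : (e + 4).-1 = e + 3)%N; last lia.
rewrite (_ : e + 4 - 3 = e + 1)%N; last lia.
rewrite (_ : e + 4 + 2 = e + 6)%N; last lia.
move: (fact_gt0 (e + 3)); move: (e + 3)`! => q q_gt0 /(_ (leq_addl _ _)) lt_q.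
rewrite !expnMn -!expnM (expnD q (2 * _)) (expnD q ((e + 3) * _)).
have pos : (0 < (e + 4) ^ (2 * (e + 6)) * (q ^ ((e + 3) * (e + 6)) * q ^ (k * (e + 6))))%N.
  by rewrite !muln_gt0 !expn_gt0 q_gt0 addnS.
rewrite -(ltn_pmul2l pos) in lt_q.
have eq_e : ((e + 3) * (e + 6) = (e + 1) * (e + 6) + 2 * (e + 6))%N by nia.
rewrite [((e + 4) ^ ((e + 3) * _))%N](_ : _ =
  (e + 4) ^ ((e + 1) * (e + 6)) * (e + 4) ^ (2 * (e + 6)))%N; last first.
  by rewrite -expnD eq_e.
move: lt_q; move: (q ^ _)%N (q ^ _)%N (q ^ _)%N (2 ^ _)%N => ? ? ? ?.
by move: ((e + 4) ^ _)%N ((e + 4) ^ _)%N => ? ?; congr (_ < _)%N; lia.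
Qed.

Local Open Scope ring_scope.

Theorem theorem1 (R : realType) (k d n : nat) (hd : (5 <= d)%N)
    (hn : n = (d ^ 2 + d - 4 + (d + 1) * k)%N) :
  (min_ham R n d
     <= (2 * (d - 1)`! ^ (d - 2) * (d - 2)`! ^ k)%N%:R%:E
     < (f R n d)%:E)%E.
Proof.
apply/andP; split.
  (* The level sizes add up to [n], so the graph can be built on ['I_n]; it then bounds the minimum
     from above. *)
  have [lev card_lev] := exists_levels (etrans (sum_level_size k hd) (esym hn)).
  have {}card_lev l : #|[pred x | lev x == l]| = level_size k d l.
    by rewrite card_lev /level_size ltnNge; case: leqP.
  apply: le_trans (bigmin_le_cond _ _ (j := level_graph k d lev) _) _.
    rewrite simple_edges_of regular_level_graph //.
    exact: level_graph_hamiltonian.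
  by rewrite lee_fin ler_nat num_level_graph_cycles.
rewrite lte_fin /f.
have q_ge0 : (0 : R) <= (d - 2)`!%:R by exact: ler0n.
have -> : d%:R + 1 = (d + 1)%:R :> R by rewrite natrD.
have -> : d%:R - 1 = (d - 1)%:R :> R by rewrite natrB //; lia.
have d1_gt0 : (0 < d + 1)%N by rewrite addn1.
(* Raising to the power [d + 1] cancels the denominator of the real exponent. *)
rewrite -(ltr_pXn2r d1_gt0) ?nnegrE ?ler0n ?mulr_ge0 ?powR_ge0 ?exprn_ge0 //.
rewrite exprMn -(powR_mulrn _ (powR_ge0 _ _)) -powRrM mulfVK ?pnatr_eq0 -?lt0n //.
rewrite powR_mulrn // -exprM -!natrX -natrM ltr_nat hn.
exact: bound_exp_lt.
Qed.
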